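(* Suppose $k\ge 17$ is odd, and $D$ is a dominating set of cardinality at most $2k+1$ for $\Delta_k$. Then there is a vertex $v\notin D$ such that defenders (guards) cannot reconfigure from $D$ to any dominating set that contains $v$. Therefore, $\gamma_{\mathrm{all}}^\infty(\Delta_k)\ge 2k+2=\gamma(\Delta_k)+2$.
   Context: For odd $k\ge 3$, let $G_k=\langle \rho,\tau,a : \rho^k=\tau^2=a^k=e,\ a\in Z(G_k),\ \tau\rho=\rho^{-1}\tau\rangle\cong D_{2k}\times C_k$, of order $2k^2$ ($D_{2k}$ is the dihedral group of order $2k$, $e$ the identity). Let $b\notin G_k$ be an element of order 2 centralising $G_k$, so $\langle G_k,b\rangle=G_k\times\langle b\rangle\cong D_{2k}\times C_{2k}$ has order $4k^2$. For a group $G$ and an inverse-closed subset $S\subseteq G$, $\mathrm{Cay}(G,S)$ is the graph with vertex set $G$ and an edge from $u$ to $us$ for every $u\in G$, $s\in S$. Let $S_k=\{\tau a^i,\rho^ia^i : 1\le i\le k-1\}\cup\{\rho\tau a,\rho\tau a^{-1}\}$, $T_k=(S_k\setminus\{\rho a,\rho^{-1}a^{-1}\})\cup\{\rho ab,\rho^{-1}a^{-1}b\}$, and $\Delta_k=\mathrm{Cay}(\langle G_k,b\rangle,T_k)$. A vertex $u$ dominates a vertex $w$ if $w=u$ or $w$ is adjacent to $u$. A dominating set is a set $D$ of vertices such that every vertex is dominated by at least one vertex of $D$; $\gamma(\Gamma)$ is the smallest size of a dominating set of $\Gamma$. Guards located at the vertices of a set $D$ (one guard per vertex) can reconfigure to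 a set $D'$ if there is a bijection $f:D\to D'$ such that for every $d\in D$, either $f(d)=d$ or $f(d)$ is adjacent to $d$. An eternal dominating configuration for $\Gamma$ is a nonempty collection $\mathcal D$ of subsets of $V(\Gamma)$, all of the same cardinality, such that for every $D_i\in\mathcal D$ and every vertex $w\notin D_i$ there is $D_j\in\mathcal D$ with $w\in D_j$ such that guards at $D_i$ can reconfigure to $D_j$. An eternal dominating set is a member of some eternal dominating configuration. The eternal domination number $\gamma_{\mathrm{all}}^\infty(\Gamma)$ is the smallest cardinality of an eternal dominating set. *)

(* Defs.v *)
From mathcomp Require Import all_boot all_fingroup all_solvable.

Set Implicit Arguments.
Unset Strict Implicit.
Unset Printing Implicit Defensive.

Section Domination.

Variables (T : finType) (e : rel T).

Definition dominates (u w : T) : bool := (w == u) || e u w.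

Definition dominating (D : {set T}) : bool :=
  [forall w, exists u in D, dominates u w].

Lemma dominating_setT : dominating setT.
Proof.
by apply/forallP=> w; apply/exists_inP; exists w; rewrite ?inE // /dominates eqxx.
Qed.

(* The bound [setT] of the arg min is dominating, so the minimum is genuine. *)
Definition domination_number : nat := #|[arg min_(D < setT | dominating D) #|D| ]|.

(* A bijection D -> D' is encoded as a self-map of T that is injective on D
   and has D' as the image of D; its values outside D are irrelevant. *)
Definition reconfigures (D D' : {set T}) : bool :=
  [exists f : {ffun T -> T},
    [&& dinjectiveb f D, f @: D == D' &
        [forall d in D, (f d == d) || e d (f d)]]].

Definition eternal_dominating_configuration (C : {set {set T}}) : bool :=
  [&& C != set0,
      [forall D in C, forall D' in C, #|D| == #|D'|] &
      [forall D in C, forall w,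
         (w \notin D) ==> [exists D' in C, (w \in D') && reconfigures D D']]].

Definition eternal_dominating (D : {set T}) : bool :=
  [exists C : {set {set T}}, eternal_dominating_configuration C && (D \in C)].

Lemma eternal_dominating_setT : eternal_dominating setT.
Proof.
apply/existsP; exists [set setT]; rewrite set11 andbT; apply/and3P; split.
- by apply/set0Pn; exists setT; rewrite set11.
- by apply/forall_inP=> D /set1P->; apply/forall_inP=> D' /set1P->.
- by apply/forall_inP=> D /set1P->; apply/forallP=> w; rewrite inE.
Qed.

Definition eternal_domination_number : nat :=
  #|[arg min_(D < setT | eternal_dominating D) #|D| ]|.

End Domination.

Local Open Scope group_scope.

(* Adjacency in Cay(gT, S): u is joined to u * s for s in S. *)
Definition cay (gT : finGroupType) (S : {set gT}) : rel gT :=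
  fun u v => [exists s in S, v == u * s].

Section DeltaGraph.

Variables (gT : finGroupType) (k : nat) (rho tau a b : gT).

Definition Gk : {group gT} := <<[set rho; tau; a]>>%G.

(* [_ \isog Grp _] only says that Gk is isomorphic to the presented group, for
   unspecified generators. As Gk is finite and generated by rho, tau and a, the
   relations on these three elements make them the presenting generators. *)
Definition Gk_presentation : Prop :=
  [/\ [/\ rho ^+ k = 1, tau ^+ 2 = 1 & a ^+ k = 1],
      a \in 'Z(Gk),
      tau * rho = rho^-1 * tau &
      Gk \isog Grp (r : t : z :
        r ^+ k, t ^+ 2, z ^+ k, z * r = r * z, z * t = t * z,
        t * r = r^-1 * t)].

(* The ambient group is <Gk, b> itself, so that all of gT is the vertex set of
   the Cayley graph below. *)
Definition Delta_group : Prop :=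
  [/\ Gk_presentation, b \notin Gk, #[b] = 2, b \in 'C(Gk) &
      <<b |: Gk>> = [set: gT]].

Definition Sk : {set gT} :=
  [set tau * a ^+ (i : nat) | i : 'I_k & 0 < i]
  :|: [set rho ^+ (i : nat) * a ^+ (i : nat) | i : 'I_k & 0 < i]
  :|: [set rho * tau * a; rho * tau * a^-1].

Definition Tk : {set gT} :=
  (Sk :\: [set rho * a; rho^-1 * a^-1])
  :|: [set rho * a * b; rho^-1 * a^-1 * b].

Definition Delta : rel gT := cay Tk.

End DeltaGraph.

(* Main.v *)
(** Write a vertex as rho^x tau^e a^y b^c, with x, y in Z/k and e, c bits.  The
    bits (e, c) cut the vertex set into four k x k tori.  A guard covers its own
    line of slope +-1 in its torus, except for the two neighbours on that line,
    which it covers in the torus with c flipped; it also covers, in the torus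
    with e flipped, its own column minus the point opposite to it, and two
    points of an adjacent column.

    With at most 2k+1 guards, counting the points which lie on no guarded line
    and in no guarded column forces one value of e for which both tori have at
    least k guards, meeting every line and every column.  At most one guard is
    then superfluous, and covering the points opposite to the guards forces all
    others onto an antidiagonal of the torus, the same one for both values of c.

    Thus a small dominating set is a doubled antidiagonal A plus at most one
    guard w.  Guards of A can only slide to a parallel antidiagonal: to swap to
    an antidiagonal of the other type, for each c two targets are reachable from
    a single common guard of A, so w would be needed twice.  Hence a vertex of
    the other type is only defended when w replaces the guard leaving A, and
    this fails at vertices with the other value of c far from w. *)

Require Import Defs.
From mathcomp Require Import all_boot all_fingroup all_solvable all_algebra.
From mathcomp Require Import zify ring.

Set Implicit Arguments.
Unset Strict Implicit.
Unset Printing Implicit Defensive.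

Import GRing.Theory.

(** * Counting with the fibres of a map *)

Section Fibers.

Variables (T I : finType) (h : T -> I).
Implicit Types A : {set T}.

Definition fiber A i : {set T} := [set p in A | h p == i].

Lemma fiber_gt0 A i : (0 < #|fiber A i|) = (i \in h @: A).
Proof.
apply/card_gt0P/imsetP=> [[p]|[p pA ->]]; last by exists p; rewrite inE pA /=.
by rewrite inE => /andP[pA /eqP<-]; exists p.
Qed.

Lemma sum_fiber A : \sum_i #|fiber A i| = #|A|.
Proof.
rewrite -sum1_card (partition_big h predT) //=; apply: eq_bigr => i _.
by rewrite -sum1_card; apply: eq_bigl => p; rewrite inE.
Qed.

(** Sum a pointwise bound over [i]: the fibre of [A'] over [t i], counted as 1 when empty, has at
    least [1 + M] elements if [A] misses [i], and at least 1 otherwise. *)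
Lemma card_missed_fibers A A' (t : I -> I) (M : nat) : injective t ->
  (forall i, i \notin h @: A -> M < #|fiber A' (t i)|) ->
  #|I| + M * #|~: (h @: A)| <= #|A'| + #|~: (h @: A')|.
Proof.
move=> t_inj hM; rewrite -sum_fiber.
have card_compl (B : {set I}) : #|~: B| = \sum_i (i \notin B).
  by rewrite -sum1dep_card big_mkcond; apply: eq_bigr => i _; case: (i \in B).
rewrite !card_compl -big_split /= [leqRHS](reindex_inj t_inj) /=.
rewrite -sum1_card big_distrr /= -big_split /=; apply: leq_sum => i _.
have := fiber_gt0 A' (t i).
case: (boolP (i \in h @: A)) => [_|/hM] /=; rewrite ?muln0 ?muln1; last by lia.
by case: (t i \in _) => /=; lia.
Qed.

Lemma onto_inj A : h @: A = setT -> #|A| <= #|I| -> {in A &, injective h}.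
Proof.
move=> onto leAI; apply/imset_injP; rewrite eqn_leq leq_imset_card onto.
by rewrite cardsT.
Qed.

(* With one element to spare, a single collision exhausts it. *)
Lemma onto_inj1 A p q : h @: A = setT -> #|A| <= #|I|.+1 -> p \in A -> q \in A ->
  p != q -> h p = h q -> {in A :\ p &, injective h}.
Proof.
move=> onto leAI pA qA pq hpq; apply: onto_inj; last first.
  by have := cardsD1 p A; rewrite pA; lia.
apply/setP=> i; rewrite inE; have: i \in h @: A by rewrite onto.
case/imsetP=> r rA ->; case: (eqVneq r p) => [->|rp].
  by rewrite hpq imset_f // !inE eq_sym pq.
by rewrite imset_f // !inE rp.
Qed.

End Fibers.

Lemma sum_bool (F : bool -> nat) b : \sum_c F c = F b + F (~~ b).
Proof. by rewrite big_bool; case: b; rewrite // addnC. Qed.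

(** * Dominating sets of the coordinate model *)

Section Torus.

Variable k : nat.
Hypothesis k_ge17 : 17 <= k.
Local Notation Z := 'Z_k.
Local Open Scope ring_scope.

Definition point : finType := ('Z_k * 'Z_k)%type.
Local Notation P := point.

Lemma card_Z : #|{: Z}| = k.
Proof. by rewrite card_ord Zp_cast //; lia. Qed.

Lemma natZ_neq0 n : (0 < n < 17)%N -> n%:R <> 0 :> Z.
Proof.
move=> n17 /(congr1 (@nat_of_ord _)); rewrite val_Zp_nat; last by lia.
by rewrite modn_small /=; lia.
Qed.

(** Right multiplication by [rho] turns rho^x tau^e into rho^(x + sgn e) tau^e. *)
Definition sgn (e : bool) : Z := if e then -1 else 1.

Lemma sgn_mulK e (z : Z) : sgn e * (sgn e * z) = z.
Proof. by case: e; rewrite /sgn; ring. Qed.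

Lemma sgnN e : sgn (~~ e) = - sgn e.
Proof. by case: e; rewrite /sgn //=; ring. Qed.

(** Invariant under right multiplication by rho^i a^i, which adds [(sgn e * i, i)]. *)
Definition line (e : bool) (p : P) : Z := p.1 - sgn e * p.2.

Section Cover.

(* [G e b] is the set of guards in the torus of the vertices
   rho^x tau^e a^y b^b.  The cases of [cov] are a guard on the line of (x, y) in
   the same torus, one on that line in the torus with [b] flipped, one in the
   same column, and one in an adjacent column. *)
Variable G : bool -> bool -> {set P}.
Hypothesis cov : forall e b (x y : Z),
  [\/ exists2 z : Z, (z != y + 1) && (z != y - 1) & (x + sgn e * (z - y), z) \in G e b,
      (x + sgn e, y + 1) \in G e (~~ b) \/ (x - sgn e, y - 1) \in G e (~~ b),
      exists2 z : Z, z != y & (x, z) \in G (~~ e) b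
    | (x + sgn e, y + 1) \in G (~~ e) b \/ (x + sgn e, y - 1) \in G (~~ e) b].

(* A point on an unguarded line and in an unguarded column is one of the two
   exceptional points covered by a guard of another torus. *)
Lemma missed_lines_columns e b :
  (#|~: (line e @: G e b)| * #|~: (fst @: G (~~ e) b)| <=
   2 * #|G e (~~ b)| + 2 * #|G (~~ e) b|)%N.
Proof.
rewrite -cardsX.
pose tr (dx dy : Z) (p : P) : P := (p.1 + dx, p.2 + dy).
pose E := (tr (- sgn e) (-1) @: G e (~~ b) :|: tr (sgn e) 1 @: G e (~~ b))
  :|: (tr (- sgn e) (-1) @: G (~~ e) b :|: tr (- sgn e) 1 @: G (~~ e) b).
(* [F (l, x)] is the point where line [l] meets column [x]. *)
pose F (q : P) : P := (q.2, sgn e * (q.2 - q.1)).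
set X := setX _ _.
have Finj : injective F.
  move=> [l x] [l' x']; rewrite /F => /eqP; rewrite xpair_eqE /= => /andP[/eqP<- /eqP].
  by move/(congr1 (fun z => sgn e * z)); rewrite !sgn_mulK => /addrI/oppr_inj->.
have sub : F @: X \subset E.
  apply/subsetP=> _ /imsetP[[l x] /setXP[/= Hl Hx] ->]; rewrite /F /=.
  move: Hl Hx; rewrite !inE => Hl Hx.
  case: (cov e b x (sgn e * (x - l))).
  - case=> z _ zG; case/negP: Hl; apply/imsetP.
    eexists; first exact: zG.
    by rewrite /line /= mulrBr sgn_mulK; ring.
  - case=> pG; rewrite -!orbA; apply/or4P; [apply: Or41|apply: Or42];
    (apply/imsetP; eexists; first exact: pG); rewrite /tr /=; congr (_, _); ring.
  - by case=> z _ zG; case/negP: Hx; apply/imsetP; eexists; first exact: zG.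
  - case=> pG; rewrite -!orbA; apply/or4P; [apply: Or43|apply: Or44];
    (apply/imsetP; eexists; first exact: pG); rewrite /tr /=; congr (_, _); ring.
have := subset_leq_card sub; rewrite card_imset // => /leq_trans-> //.
have leU (A B : {set P}) := leq_card_setU A B.
have leI (A : {set P}) dx dy : (#|tr dx dy @: A| <= #|A|)%N.
  exact: leq_imset_card.
rewrite /E (leq_trans (leU _ _)) // leq_add // (leq_trans (leU _ _)) //.
  by rewrite mul2n -addnn leq_add.
by rewrite mul2n -addnn leq_add.
Qed.

(** Count how the [k] points of column [x] in torus [(~~ e, b)] are covered. A guard of the same
    torus covers at most one of them, and a guard with [b] flipped at most two. The guards of torus
    [(e, b)] avoid column [x], so they help only from the adjacent column, with two points each. *)
Lemma missed_column e b (x : Z) : x \notin fst @: G e b ->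
  (k <= #|G (~~ e) b| + 2 * #|G (~~ e) (~~ b)| +
        2 * #|fiber fst (G e b) (x - sgn e)%R|)%N.
Proof.
move=> xU.
pose h1 (p : P) : Z := p.2 - sgn (~~ e) * (p.1 - x).
pose up (p : P) : Z := p.2 - 1.
pose dn (p : P) : Z := p.2 + 1.
set A := G (~~ e) b; set B := G _ (~~ b); set F := fiber _ _ _.
have sub : [set: Z] \subset h1 @: A :|: ((up @: B :|: dn @: B) :|: (up @: F :|: dn @: F)).
  apply/subsetP=> y _; rewrite !inE.
  case: (cov (~~ e) b x y); rewrite ?negbK ?sgnN.
  - case=> z _ zG; apply/orP; left; apply/imsetP; eexists; first exact: zG.
    by rewrite /h1; case: (e); rewrite /sgn /=; ring.
  - case=> pG; apply/orP; right; apply/orP; left; apply/orP; [left|right];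
    (apply/imsetP; eexists; first exact: pG); rewrite /up /dn /=; ring.
  - by case=> z _ zG; case/negP: xU; apply/imsetP; eexists; first exact: zG.
  - case=> pG; apply/orP; right; apply/orP; right; apply/orP; [left|right];
    (apply/imsetP; eexists; first by rewrite inE; apply/andP; split; [exact: pG|]);
    rewrite /up /dn /=; ring.
have := subset_leq_card sub; rewrite cardsT card_Z => /leq_trans-> //.
have leU (C D : {set Z}) := leq_card_setU C D.
rewrite -addnA (leq_trans (leU _ _)) // leq_add ?leq_imset_card //.
rewrite (leq_trans (leU _ _)) // !mul2n -!addnn leq_add //.
  by rewrite (leq_trans (leU _ _)) // leq_add // leq_imset_card.
by rewrite (leq_trans (leU _ _)) // leq_add // leq_imset_card.
Qed.

(** Count how the [k] points of line [l] in torus [(e, b)] are covered. A guard with [b] flipped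
    covers two of them, and only from line [l]. A guard with [e] flipped covers at most three: one
    in its own column and two in the adjacent one. *)
Lemma missed_line e b (l : Z) : l \notin line e @: G e b ->
  (k <= 2 * #|fiber (line e) (G e (~~ b)) l| + 3 * #|G (~~ e) b|)%N.
Proof.
move=> lU.
pose h1 (p : P) : Z := sgn e * (p.1 - l).
pose up (p : P) : Z := p.2 - 1.
pose dn (p : P) : Z := p.2 + 1.
set A := G (~~ e) b; set F := fiber _ _ _.
have sub : [set: Z] \subset h1 @: A :|: ((up @: A :|: dn @: A) :|: (up @: F :|: dn @: F)).
  apply/subsetP=> y _; rewrite !inE.
  case: (cov e b (l + sgn e * y) y).
  - case=> z _ zG; case/negP: lU; apply/imsetP; eexists; first exact: zG.
    by rewrite /line /=; ring.
  - case=> pG; apply/orP; right; apply/orP; right; apply/orP; [left|right];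
    (apply/imsetP; eexists; first by rewrite inE; apply/andP; split;
       [exact: pG|apply/eqP; rewrite /line /=; ring]);
    rewrite /up /dn /=; ring.
  - case=> z _ zG; apply/orP; left; apply/imsetP; eexists; first exact: zG.
    by rewrite /h1 /= addrAC subrr add0r sgn_mulK.
  - case=> pG; apply/orP; right; apply/orP; left; apply/orP; [left|right];
    (apply/imsetP; eexists; first exact: pG); rewrite /up /dn /=; ring.
have := subset_leq_card sub; rewrite cardsT card_Z => /leq_trans-> //.
have leU (C D : {set Z}) := leq_card_setU C D.
have -> : (2 * #|F| + 3 * #|A| = #|A| + ((#|A| + #|A|) + (#|F| + #|F|)))%N by lia.
do !apply: leq_trans (leU _ _) (leq_add _ _); exact: leq_imset_card.
Qed.

Hypothesis sizeG : (\sum_e \sum_b #|G e b| <= 2 * k + 1)%N.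

Lemma size_sheets e b :
  (#|G e b| + #|G e (~~ b)| + #|G (~~ e) b| + #|G (~~ e) (~~ b)| <= 2 * k + 1)%N.
Proof. by move: sizeG; rewrite (sum_bool _ e) !(sum_bool _ b) addnA. Qed.

Lemma small_product e b :
  ((k - #|G e b|) * (k - #|G (~~ e) b|) <= 2 * #|G e (~~ b)| + 2 * #|G (~~ e) b|)%N.
Proof.
apply: leq_trans (missed_lines_columns e b).
have leC (f : P -> Z) (A : {set P}) : (k - #|A| <= #|~: (f @: A)|)%N.
  have := cardsC (f @: A); rewrite card_Z.
  by have : (#|f @: A| <= #|A|)%N := leq_imset_card _ _; lia.
exact: leq_mul.
Qed.

(** Choose [b] whose two tori hold at most [k] guards, and [e] so that [(e, b)] is the larger one.
    Adding the bounds of [small_product] for [e] and [~~ e] bounds the product of the two deficits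
    from [k] by [2 * k + 1], so the smaller deficit is at most 2. *)
Lemma dominant_sheet : exists e b,
  [/\ (k <= #|G e b| + 2)%N, (k <= #|G e (~~ b)| + 3)%N,
      (#|G (~~ e) b| <= 2)%N & (#|G (~~ e) (~~ b)| <= 6)%N].
Proof.
have [b [e [sum_le le]]] : exists b e,
    (#|G e b| + #|G (~~ e) b| <= k)%N /\ (#|G (~~ e) b| <= #|G e b|)%N.
  have [b sum_le] : exists b, (#|G false b| + #|G true b| <= k)%N.
    have sz : (#|G false false| + #|G false true| + #|G true false| +
      #|G true true| <= 2 * k + 1)%N := size_sheets false false.
    case: (leqP (#|G false false| + #|G true false|) k) => [|gt]; first by exists false.
    by exists true; lia.
  exists b; case: (leqP #|G true b| #|G false b|) => le.
    by exists false.
  by exists true; split; last exact: ltnW; rewrite addnC.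
exists e, b.
have sz := size_sheets e b.
have p1 := small_product e b; have p2 := small_product (~~ e) b.
have p3 := small_product e (~~ b); have p4 := small_product (~~ e) (~~ b).
rewrite ?negbK in p1 p2 p3 p4.
set r0 := #|G e b| in sz p1 p2 p3 p4 sum_le le *.
set f0 := #|G (~~ e) b| in sz p1 p2 p3 p4 sum_le le *.
set r1 := #|G e (~~ b)| in sz p1 p2 p3 p4 *.
set f1 := #|G (~~ e) (~~ b)| in sz p1 p2 p3 p4 *.
have u_le : (k - r0 <= 2)%N.
  rewrite leqNgt; apply/negP=> u3.
  have : ((k - r0) * (k - f0) <= 2 * k + 1)%N by lia.
  have : (3 <= k - r0 <= k - f0)%N by lia.
  have : (k <= (k - r0) + (k - f0))%N by lia.
  move: (k - r0)%N (k - f0)%N => u w; nia.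
have [r1_big|r1_small] := leqP k (r1 + 3); first by split; lia.
(* In the remaining case, to be refuted, the product bound for [~~ b] makes [(~~ e, ~~ b)] the other
   large torus. *)
have f1_big : (k <= f1 + 3)%N.
  rewrite leqNgt; apply/negP=> f1_small.
  have : ((k - r1) * (k - f1) <= 2 * k + 1)%N by lia.
  have : (k - 3 <= (k - r1) + (k - f1))%N by lia.
  have : (4 <= k - r1)%N by lia.
  have : (4 <= k - f1)%N by lia.
  move: (k - r1)%N (k - f1)%N => u w; nia.
have r0k : (k <= r0)%N.
  rewrite leqNgt; apply/negP=> u1.
  have : (1 <= k - r0)%N by lia.
  have : (k - 2 <= k - f0)%N by lia.
  have : ((k - r0) * (k - f0) <= 12)%N by lia.
  move: (k - r0)%N (k - f0)%N => u w; nia.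
have G0 : G (~~ e) b = set0 by apply/eqP; rewrite -cards_eq0; apply/eqP; rewrite -/f0; lia.
have U0 : line e @: G e b = setT.
  apply/eqP; rewrite -subTset -setCS setCT subset0 -cards_eq0; apply/eqP.
  have := missed_lines_columns e b.
  rewrite G0 imset0 setC0 cardsT card_Z cards0; rewrite -/r1; nia.
have injL : {in G e b &, injective (line e)} by apply: onto_inj => //; rewrite card_Z; lia.
pose tr (p : P) : P := (p.1 - 2 * sgn e, p.2 - 2).
(* Every line carries exactly one guard of [G e b], so the neighbour of that
   guard is covered from [G e (~~ b)], which is too small for that. *)
have sub : G e b \subset G e (~~ b) :|: tr @: G e (~~ b).
  apply/subsetP=> -[x y] xyG; rewrite inE.
  case: (cov e b (x + sgn e) (y + 1)); rewrite ?G0.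
  - case=> z /andP[_ zy] zG; case/eqP: zy.
    have /(congr1 snd)/= : (x + sgn e + sgn e * (z - (y + 1)), z) = (x, y).
      by apply: injL => //; rewrite /line /=; ring.
    by move->; ring.
  - case=> pG; apply/orP; last by left; move: pG; rewrite !addrK.
    right; apply/imsetP; eexists; first exact: pG.
    by rewrite /tr /=; congr (_, _); ring.
  - by case=> z _; rewrite inE.
  - by case; rewrite inE.
have : (r0 <= r1 + r1)%N.
  apply: leq_trans (subset_leq_card sub) (leq_trans (leq_card_setU _ _) _).
  exact: leq_add (leqnn _) (leq_imset_card _ _).
lia.
Qed.

(** By [missed_column], each unguarded column [x] forces more than [M] guards into column
    [x - sgn e]. *)
Lemma all_columns e b M :
  (2 * M + #|G (~~ e) b| + 2 * #|G (~~ e) (~~ b)| < k)%N ->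
  (k + M * #|~: (fst @: G e b)| <= #|G e b| + #|~: (fst @: G e b)|)%N.
Proof.
move=> small.
suff: (#|{: Z}| + M * #|~: (fst @: G e b)| <= #|G e b| + #|~: (fst @: G e b)|)%N.
  by rewrite card_Z.
apply: (@card_missed_fibers _ _ _ _ _ (fun x : Z => x - sgn e)); first exact: addIr.
by move=> x /missed_column; lia.
Qed.

Lemma full_sheets : exists e, forall b,
  [/\ (k <= #|G e b|)%N, fst @: G e b = setT & line e @: G e b = setT].
Proof.
have [e [b [r0 r1 f0 f1]]] := dominant_sheet.
have big c : (k <= #|G e c|)%N.
  (* The bounds of [dominant_sheet] make the left side at most 2 + 2 + 2 * 6 = 16. *)
  have : (2 * 1 + #|G (~~ e) c| + 2 * #|G (~~ e) (~~ c)| < k)%N.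
    have [->|->] : c = b \/ c = ~~ b by case: (c); case: (b); auto.
      by lia.
    by rewrite negbK; lia.
  by move/all_columns; rewrite mul1n leq_add2r.
have compl0 (A : {set Z}) : #|~: A| = 0%N -> A = setT.
  by move/eqP; rewrite cards_eq0 => /eqP A0; rewrite -[A]setCK A0 setC0.
have sz c := size_sheets e c.
have lines d : (k + 6 * #|~: (line e @: G e d)| <=
    #|G e (~~ d)| + #|~: (line e @: G e (~~ d))|)%N.
  suff: (#|{: Z}| + 6 * #|~: (line e @: G e d)| <=
    #|G e (~~ d)| + #|~: (line e @: G e (~~ d))|)%N by rewrite card_Z.
  apply: (@card_missed_fibers _ _ _ _ _ id) => // l /missed_line.
  by have := sz d; have := big d; have := big (~~ d); lia.
exists e => c; split=> //; apply: compl0.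
  have: #|~: (fst @: G e c)| = 0%N; last by [].
  (* By [big] at most one guard has type [~~ e], so the left side is again at most 16. With [M = 7]
     a missed column costs six guards net, and only one is spare. *)
  have : (2 * 7 + #|G (~~ e) c| + 2 * #|G (~~ e) (~~ c)| < k)%N.
    by have := sz c; have := big c; have := big (~~ c); lia.
  by move/all_columns; have := sz c; have := big (~~ c); lia.
have: #|~: (line e @: G e c)| = 0%N; last by [].
by have := lines c; have := lines (~~ c); rewrite negbK; have := sz c; lia.
Qed.

Lemma mem_point (A : {set P}) (x y x' y' : Z) :
  (x, y) \in A -> x = x' -> y = y' -> (x', y') \in A.
Proof. by move=> + <- <-. Qed.

Lemma guard_antidiagonal : exists e c, forall b x, (x, c - sgn e * x) \in G e b.
Proof.
have [e full] := full_sheets.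
have r_ge b : (k <= #|G e b|)%N by have [] := full b.
have cols b : fst @: G e b = setT by have [] := full b.
have lines b : line e @: G e b = setT by have [] := full b.
(* There is at most one spare guard, so some value of [b] avoids it; torus [(e, b)] then has exactly
   one guard on each line and in each column. *)
have [b [rb fb]] : exists b, (#|G e b| <= k)%N /\ #|G (~~ e) b| = 0%N.
  move: (size_sheets e true) (r_ge true) (r_ge (~~ true)); move: (~~ true) => d sz r1 r2.
  case: (boolP ((#|G e true| <= k)%N && (#|G (~~ e) true| == 0%N))) => [/andP[? /eqP]|].
    by exists true.
  by rewrite negb_and -ltnNge -lt0n => /orP[?|?]; exists d; split; lia.
have sz := size_sheets e b; have rgb := r_ge b; have rnb := r_ge (~~ b).
have Fb0 p : p \in G (~~ e) b = false by rewrite (cards0_eq fb) inE.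
have col_inj : {in G e b &, injective fst} by apply: onto_inj; rewrite ?card_Z.
have line_inj : {in G e b &, injective (line e)} by apply: onto_inj; rewrite ?card_Z.
have line_inj1 p q : p \in G e (~~ b) -> q \in G e (~~ b) -> p != q ->
    line e p = line e q -> {in G e (~~ b) :\ p &, injective (line e)}.
  by apply: onto_inj1 => //; rewrite card_Z; lia.
(* The two neighbours of a guard on its line must be covered from torus [(e, ~~ b)], where each has
   two candidates, one of them being [(x, y)]. *)
have around x y : (x, y) \in G e b -> (x, y) \in G e (~~ b) \/
    (x + 2 * sgn e, y + 2) \in G e (~~ b) /\ (x - 2 * sgn e, y - 2) \in G e (~~ b).
  move=> xyG; case: (boolP ((x, y) \in G e (~~ b))) => [|xyN]; first by left.
  right; split.
    case: (cov e b (x + sgn e) (y + 1)).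
    - case=> z /andP[_ zy] zG; case/eqP: zy.
      have /(congr1 snd)/= -> : (x + sgn e + sgn e * (z - (y + 1)), z) = (x, y).
        by apply: line_inj => //; rewrite /line /=; ring.
      by ring.
    - case; last by rewrite !addrK (negbTE xyN).
      by move/mem_point; apply; ring.
    - by case=> z _; rewrite Fb0.
    - by rewrite !Fb0; case.
  case: (cov e b (x - sgn e) (y - 1)).
  - case=> z /andP[zy _] zG; case/eqP: zy.
    have /(congr1 snd)/= -> : (x - sgn e + sgn e * (z - (y - 1)), z) = (x, y).
      by apply: line_inj => //; rewrite /line /=; ring.
    by ring.
  - case; first by rewrite !subrK (negbTE xyN).
    by move/mem_point; apply; ring.
  - by case=> z _; rewrite Fb0.
  - by rewrite !Fb0; case.
(* The alternative [G e (~~ b)] would have two guards on one line, which uses up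
   its spare guard and leaves the column of (x, y) unguarded. *)
have two_apart x y : (x, y) \in G e b -> (x, y) \notin G e (~~ b) ->
    exists p q, [/\ p \in G e (~~ b), q \in G e (~~ b), p != q,
                    line e p = line e (x, y) /\ line e q = line e (x, y) & p.1 != x /\ q.1 != x].
  move=> xyG xyN; case: (around x y xyG) => [|[pG qG]]; first by rewrite (negbTE xyN).
  exists (x + 2 * sgn e, y + 2), (x - 2 * sgn e, y - 2); split=> //=.
  - rewrite xpair_eqE negb_and; apply/orP; right; apply/eqP=> E.
    apply: (@natZ_neq0 4) => //; have -> : 4%:R = (y + 2) - (y - 2) :> Z by ring.
    by rewrite E subrr.
  - by rewrite /line /=; split; ring.
  - have n2 : 2 * sgn e != 0.
      apply/eqP=> E; apply: (@natZ_neq0 2) => //.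
      have -> : 2%:R = sgn e * (2 * sgn e) :> Z by case: (e); rewrite /sgn; ring.
      by rewrite E mulr0.
    by rewrite -subr_eq0 addrAC subrr add0r -[x in _ - _ != x]addr0 (inj_eq (addrI _)) oppr_eq0.
have sub : G e b \subset G e (~~ b).
  apply/subsetP=> -[x y] xyG; apply/negPn/negP => xyN.
  have [p [q [pG qG pq [lp lq] [px qx]]]] := two_apart x y xyG xyN.
  have /imsetP[[x' y'] hG /= xx'] : x \in fst @: G e (~~ b) by rewrite cols.
  rewrite -{}xx' {x'} in hG.
  have inj := line_inj1 p q pG qG pq (etrans lp (esym lq)).
  have hp : (x, y') != p by apply: contraNneq px => <-.
  have hq : (x, y') != q by apply: contraNneq qx => <-.
  (* If this guard is in [G e (~~ b)], it is [(x, y')], hence [(x, y)] by [col_inj]; if not,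
     [two_apart] gives a second pair of guards on one line. Should the line be that of [p] and [q],
     it would carry three guards. *)
  have /imsetP[[x1 y1] gG gl] : line e (x, y') \in line e @: G e b by rewrite lines.
  case: (boolP ((x1, y1) \in G e (~~ b))) => [gG'|gN].
    case: (eqVneq (x1, y1) p) => [g_p|gp].
      have : (x, y') = q by apply: inj; rewrite ?inE ?hp ?hG ?(eq_sym q) ?pq ?qG // gl g_p lp.
      by move/eqP; rewrite (negbTE hq).
    have [x1x y1y] : (x, y') = (x1, y1) by apply: inj; rewrite ?inE ?hp ?hG ?gp ?gG'.
    rewrite -x1x -y1y in gG.
    have E : (x, y') = (x, y) by apply: col_inj.
    by rewrite E (negbTE xyN) in hG.
  have [p' [q' [pG' qG' pq' [lp' lq'] _]]] := two_apart x1 y1 gG gN.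
  have [E|lne] := eqVneq (line e p') (line e p).
    have : (x, y') = q; last by move/eqP; rewrite (negbTE hq).
    by apply: inj; rewrite ?inE ?hp ?hG ?(eq_sym q) ?pq ?qG // gl -lp' E lp lq.
  case/eqP: pq'; apply: inj; last by rewrite lp' lq'.
    by rewrite !inE pG' andbT; apply: contraNneq lne => ->.
  by rewrite !inE qG' andbT; apply: contraNneq lne => <-; rewrite lp' lq'.
(* The point opposite to (x, y) in torus (~~ e, b) is covered from the adjacent
   column: a guard outside of [G e] covers it for at most one value of [b], and
   when there is such a guard, [G e] does not depend on [b]. *)
have step x y : (x, y) \in G e b -> (x - sgn e, y + 1) \in G e b.
  move=> xyG.
  (* The other candidate in the adjacent column lies on the line of [(x, y)], which has no second
     guard. *)
  have back : (x - sgn e, y - 1) \in G e b -> (x - sgn e, y + 1) \in G e b.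
    move=> pG; have /(congr1 snd)/= : (x, y) = (x - sgn e, y - 1).
      by apply: line_inj => //; rewrite /line /=; ring.
    move=> E; case: (@natZ_neq0 1) => //.
    by have -> : 1%:R = y - (y - 1) :> Z by [ring]; rewrite -E subrr.
  have [Fnb0|Fnb] := eqVneq #|G (~~ e) (~~ b)| 0%N.
    have Fnb p : p \in G (~~ e) (~~ b) = false by rewrite (cards0_eq Fnb0) inE.
    case: (cov (~~ e) b x y); rewrite ?negbK ?sgnN.
    - by case=> z _; rewrite Fb0.
    - by rewrite !Fnb; case.
    - case=> z zy zG; case/eqP: zy.
      by have /(congr1 snd) : (x, z) = (x, y) by apply: col_inj.
    - by case=> // /back.
  have eqG : G e (~~ b) = G e b by apply/esym/eqP; rewrite eqEcard sub; lia.
  have Fnb1 : (#|G (~~ e) (~~ b)| <= 1)%N by lia.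
  case: (cov (~~ e) (~~ b) x y); rewrite ?negbK ?sgnN ?eqG.
  - case=> z /andP[zy1 zy2] zG.
    case: (cov (~~ e) b x y); rewrite ?negbK ?sgnN.
    + by case=> z' _; rewrite Fb0.
    + case=> wG; have /(congr1 snd)/= E := card_le1_eqP Fnb1 _ _ zG wG.
        by rewrite E eqxx in zy1.
      by rewrite E eqxx in zy2.
    + case=> z' zy zG'; case/eqP: zy.
      by have /(congr1 snd) : (x, z') = (x, y) by apply: col_inj.
    + by case=> // /back.
  - by rewrite !Fb0; case.
  - case=> z zy zG; case/eqP: zy.
    by have /(congr1 snd) : (x, z) = (x, y) by apply: col_inj.
  - by case=> // /back.
have /imsetP[[x0 c] cG /= x00] : (0 : Z) \in fst @: G e b by rewrite cols inE.
rewrite -{}x00 in cG.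
have walk n : (- sgn e * n%:R, c + n%:R) \in G e b.
  elim: n => [|n IHn]; first by rewrite mulr0 addr0.
  by apply: mem_point (step _ _ IHn) _ _; rewrite -natr1; ring.
exists e, c => b' x.
have xG : (x, c - sgn e * x) \in G e b.
  apply: mem_point (walk (nat_of_ord (- sgn e * x))) _ _; rewrite natr_Zp; last by ring.
  by case: (e); rewrite /sgn; ring.
have [->|->] : b' = b \/ b' = ~~ b by case: (b'); case: (b); auto.
  exact: xG.
exact: subsetP sub _ xG.
Qed.

End Cover.

(** * The graph in torus coordinates *)

Definition vertex : finType := ((bool * bool) * ('Z_k * 'Z_k))%type.

(* ((e, b), (x, y)) stands for rho^x tau^e a^y b^b. *)
Definition torus_adj : rel vertex := fun u v =>
  let: ((e, b), (x, y)) := u in let: ((e', b'), (x', y')) := v in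
  let near := (y' - y == 1) || (y' - y == -1) in
  if e == e' then [&& x' - x == sgn e * (y' - y), y' != y & (b != b') == near]
  else (b == b') && ((x' == x) && (y' != y) || (x' == x + sgn e) && near).

Definition sheet (D : {set vertex}) e b : {set point} := [set p | ((e, b), p) \in D].

Lemma card_sheets (D : {set vertex}) : (\sum_e \sum_b #|sheet D e b| = #|D|)%N.
Proof.
pose h (u : vertex) := u.1.
rewrite -(sum_fiber h) (pair_bigA _ (fun e b => #|sheet D e b|)) /=.
apply: eq_bigr => -[e b] _; have inj : injective (fun p : point => ((e, b), p) : vertex).
  by move=> p q [].
rewrite -(card_imset _ inj); apply: eq_card => -[eb p]; rewrite !inE.
apply/imsetP/andP => [[q]|[uD /eqP /= ebE]].
  by rewrite inE => qD [-> ->].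
by exists p; rewrite ?inE -/(e, b) -?ebE.
Qed.

Lemma mem_vertex (D : {set vertex}) e b (x y x' y' : Z) :
  ((e, b), (x, y)) \in D -> x = x' -> y = y' -> ((e, b), (x', y')) \in D.
Proof. by move=> + <- <-. Qed.

(** Reads [torus_adj] from the dominated vertex, to supply the hypothesis [cov]. A guard on the
    vertex itself falls under the first case with [z = y]. *)
Lemma sheet_cover D : dominating torus_adj D -> forall e b (x y : Z),
  [\/ exists2 z : Z,
        (z != y + 1) && (z != y - 1) & (x + sgn e * (z - y), z) \in sheet D e b,
      (x + sgn e, y + 1) \in sheet D e (~~ b) \/ (x - sgn e, y - 1) \in sheet D e (~~ b),
      exists2 z : Z, z != y & (x, z) \in sheet D (~~ e) b
    | (x + sgn e, y + 1) \in sheet D (~~ e) b \/ (x + sgn e, y - 1) \in sheet D (~~ e) b].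
Proof.
move=> /forallP domD e b x y.
have /exists_inP[[[e' b'] [x' y']] gD] := domD ((e, b), (x, y)).
have n1 : 1 != 0 :> Z by apply: oner_neq0.
case/orP=> [/eqP[-> -> -> ->]|].
  apply: Or41; exists y'; last by rewrite inE subrr mulr0 addr0.
  rewrite eq_sym -subr_eq0 addrAC subrr add0r n1 eq_sym -subr_eq0 addrAC subrr.
  by rewrite add0r oppr_eq0 n1.
have near_cases : (y - y' == 1) || (y - y' == -1) -> y' = y - 1 \/ y' = y + 1.
  by case/orP=> /eqP E; [left|right]; rewrite -[y'](subKr y) E ?opprK.
rewrite /torus_adj; case: eqP => [ee|/eqP ee].
  case/and3P=> /eqP Ex yy; rewrite {}ee in Ex gD.
  case near: ((y - y' == 1) || (y - y' == -1)) => /eqP.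
    move=> /eqP bb; have {bb}b'E : b' = ~~ b by move: bb; case: (b'); case: (b).
    rewrite {}b'E in gD.
    have xE : x' = x - sgn e * (y - y') by rewrite -Ex; ring.
    case/near_cases: near => yE; rewrite {}yE in xE gD; apply: Or42; [right|left];
      rewrite inE; apply: mem_vertex gD _ _; rewrite ?xE; ring.
  move=> /negbFE/eqP b'E; rewrite {}b'E in gD.
  apply: Or41; exists y'.
    by move/norP: near => [N1 N2]; apply/andP; split; apply/eqP=> E; rewrite E in N1 N2;
      [case/eqP: N2|case/eqP: N1]; ring.
  have xE : x' = x + sgn e * (y' - y) by rewrite -[x](subrK x') Ex; ring.
  by rewrite inE -xE.
have e'E : e' = ~~ e by move: ee; case: (e'); case: (e).
rewrite {}e'E in gD *; case/andP=> /eqP b'E; rewrite {}b'E in gD.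
case/orP=> /andP[/eqP xE].
  rewrite {}xE; move=> yy; apply: Or43; exists y'; last by rewrite inE.
  by rewrite eq_sym.
move/near_cases => near; apply: Or44; rewrite {}xE sgnN.
by case: near => yE; rewrite yE in gD; [right|left]; rewrite inE subrK.
Qed.

Lemma dominating_antidiagonal D : dominating torus_adj D -> (#|D| <= 2 * k + 1)%N ->
  exists e c, forall b x, ((e, b), (x, c - sgn e * x)) \in D.
Proof.
move=> domD; rewrite -card_sheets => sizeD.
have [e [c AD]] := guard_antidiagonal (sheet_cover domD) sizeD.
by exists e, c => b x; have := AD b x; rewrite inE.
Qed.

(** * Reconfiguration in the coordinate model *)

Definition antidiagonal e c : {set vertex} :=
  [set u : vertex | (u.1.1 == e) && (u.2.2 == c - sgn e * u.2.1)].

Lemma in_antidiagonal e c e' b (x y : Z) :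
  (((e', b), (x, y)) \in antidiagonal e c) = (e' == e) && (y == c - sgn e * x).
Proof. by rewrite inE. Qed.

Lemma card_antidiagonal e c : #|antidiagonal e c| = (2 * k)%N.
Proof.
pose h (bx : bool * Z) : vertex := ((e, bx.1), (bx.2, c - sgn e * bx.2)).
have inj : injective h by move=> [b x] [b' x'] [-> -> _].
have <- : #|h @: setT| = (2 * k)%N.
  by rewrite card_imset // cardsT card_prod card_bool card_Z.
apply: eq_card => -[[e' b] [x y]]; rewrite in_antidiagonal.
apply/andP/imsetP => [[/eqP-> /eqP->]|[[b' x'] _ [-> _ -> ->]]]; last by [].
by exists (b, x).
Qed.

Lemma dominating_has_antidiagonal (D : {set vertex}) :
  dominating torus_adj D -> (#|D| <= 2 * k + 1)%N ->
  exists e c, antidiagonal e c \subset D.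
Proof.
move=> domD sizeD; have [e [c AD]] := dominating_antidiagonal domD sizeD.
exists e, c; apply/subsetP=> -[[e' b] [x y]].
by rewrite in_antidiagonal => /andP[/eqP-> /eqP->].
Qed.

Lemma antidiagonal_plus_one (D : {set vertex}) e c :
  antidiagonal e c \subset D -> (#|D| <= 2 * k + 1)%N ->
  exists w, D \subset w |: antidiagonal e c.
Proof.
move=> AD sizeD.
have : (#|D :\: antidiagonal e c| <= 1)%N.
  by have := cardsID (antidiagonal e c) D; rewrite (setIidPr AD) card_antidiagonal; lia.
case: (set_0Vmem (D :\: antidiagonal e c)) => [D0 _|[w wD] /card_le1_eqP D1].
  (* Without a spare guard, any vertex serves as [w]. *)
  exists ((e, true), (0, 0)); rewrite subsetU // orbC.
  by rewrite -setD_eq0 D0 eqxx.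
exists w; apply/subsetP=> u uD; rewrite in_setU1.
case: (boolP (u \in antidiagonal e c)) => uA; first by rewrite orbT.
by rewrite (D1 u w) ?eqxx // inE uA uD.
Qed.

Definition moves (u v : vertex) := (v == u) || torus_adj u v.

Lemma near0 : (0 == 1 :> Z) || (0 == -1 :> Z) = false.
Proof. by rewrite ![0 == _]eq_sym oppr_eq0 oner_eq0. Qed.

Lemma moves_same e b b' (x y x' y' : Z) :
  moves ((e, b), (x, y)) ((e, b'), (x', y')) ->
  line e (x', y') = line e (x, y) /\
  (b != b') = (y' - y == 1) || (y' - y == -1).
Proof.
case/orP=> [/eqP[-> -> ->]|]; first by rewrite subrr eqxx near0.
rewrite /torus_adj eqxx => /and3P[/eqP Ex _ /eqP->]; split=> //.
by rewrite /line /= -[x'](subrK x) Ex; ring.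
Qed.

Lemma moves_cross e b b' (x y x' y' : Z) :
  moves ((e, b), (x, y)) ((~~ e, b'), (x', y')) ->
  b = b' /\ (x' = x /\ y' <> y \/ x' = x + sgn e /\ (y' = y + 1 \/ y' = y - 1)).
Proof.
case/orP=> [/eqP[]|]; first by case: (e).
have -> : torus_adj ((e, b), (x, y)) ((~~ e, b'), (x', y')) =
  (b == b') && ((x' == x) && (y' != y) ||
     (x' == x + sgn e) && ((y' - y == 1) || (y' - y == -1))) by case: (e).
case/andP=> /eqP-> /orP[/andP[/eqP-> /eqP ?]|/andP[/eqP-> near]]; split=> //.
  by left.
by right; split=> //; case/orP: near => /eqP E; [left|right]; rewrite -E; ring.
Qed.

Lemma torus_adj_same e b b' (x y x' y' : Z) :
  x' - x = sgn e * (y' - y) -> y' != y ->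
  b' = b (+) ((y' - y == 1) || (y' - y == -1)) ->
  torus_adj ((e, b), (x, y)) ((e, b'), (x', y')).
Proof.
by move=> Ex yy ->; rewrite /torus_adj eqxx Ex eqxx yy; case: (b); case: (_ || _).
Qed.

Hypothesis k_odd : odd k.

(** The inverse of 2 modulo the odd number [k]. *)
Definition half : Z := (k./2.+1)%:R.

Lemma halfK (z : Z) : half * z + half * z = z.
Proof.
rewrite -mulrDl -natrD (_ : (_ + _)%N = k + 1)%N; last by lia.
by rewrite natrD pchar_Zp ?add0r ?mul1r //; lia.
Qed.

(** As 2 is invertible, each line meets the antidiagonal in one point; of the two guards there, one
    for each bit, exactly one covers a given vertex of the line. In the other type, the guard of the
    same column covers all but the opposite point, which the adjacent column covers. *)
Lemma dominating_antidiagonal0 : dominating torus_adj (antidiagonal false 0).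
Proof.
apply/forallP=> -[[e b] [x y]]; apply/exists_inP.
have s1 : sgn false = 1 by [].
case: e.
  have [->|yx] := eqVneq y (- x).
    exists ((false, b), (x - 1, - (x - 1))).
      by rewrite in_antidiagonal s1; apply/andP; split=> //; apply/eqP; ring.
    rewrite /dominates /torus_adj /= !eqxx ?s1 subrK eqxx /=; apply/orP; right.
    by rewrite (_ : - x - - (x - 1) = -1) ?eqxx ?orbT //; ring.
  exists ((false, b), (x, - x)).
    by rewrite in_antidiagonal s1; apply/andP; split=> //; apply/eqP; ring.
  by apply/orP; right; rewrite /torus_adj /= !eqxx yx.
pose x' := half * (x - y).
have x'E : x - y = x' + x' by rewrite halfK.
pose near := (y + x' == 1) || (y + x' == -1).
exists ((false, b (+) near), (x', - x')).
  by rewrite in_antidiagonal s1; apply/andP; split=> //; apply/eqP; ring.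
have [yx|yx] := eqVneq y (- x').
  have xx : x = x' by rewrite -[x](subrK y) x'E yx; ring.
  apply/orP; left; rewrite /near yx addNr near0.
  by rewrite addbF xx.
apply/orP; right; apply: torus_adj_same => //.
  by rewrite s1 -[x](subrK y) x'E; ring.
by rewrite opprK -/near addbK.
Qed.

Lemma undefendable (D : {set vertex}) e c w :
  antidiagonal e c \subset D -> D \subset w |: antidiagonal e c ->
  exists2 v, v \notin D & forall D', dominating torus_adj D' -> (#|D'| <= 2 * k + 1)%N ->
    v \in D' -> ~~ reconfigures torus_adj D D'.
Proof.
case: w => -[ew bw] [p q] AD DA.
(* [x0] is the column of the guards of the antidiagonal on the line of w. *)
pose x0 := half * (line e (p, q) + sgn e * c).
(* If [w] has type [e], the offset 2 keeps every antidiagonal guard that can reach [v] off the line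
   of [w]. Otherwise [w] could replace such a guard only if [xv] were within distance 2 of [p]. *)
pose xv : Z := if ew == e then x0 + 2 * sgn e else p + 3.
pose v : vertex := ((~~ e, ~~ bw), (xv, 0)).
have n3 n : (0 < n < 17)%N -> (n%:R == 0 :> Z) = false by move=> /natZ_neq0/eqP/negbTE.
have wv : ~~ moves ((ew, bw), (p, q)) v.
  apply/negP; rewrite /v /xv; have [->|ewe] := eqVneq ew e.
    by case/moves_cross=> bE _; case: (bw) bE.
  have -> : ew = ~~ e by case: (ew) ewe; case: (e).
  case/moves_same; rewrite /line /= => Ex.
  have -> : bw != ~~ bw by case: (bw).
  move/esym/orP=> near.
  have E3 : 3 = sgn (~~ e) * (0 - q).
    by apply: (addrI p); rewrite -[LHS](subrK (sgn (~~ e) * 0)) Ex; ring.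
  case: near => /eqP E; move: E3; rewrite E; case: (e); rewrite /sgn /= => E3.
  - case: (@natZ_neq0 2%N) => //; have -> : 2%:R = 3 - 1 * 1 :> Z by ring.
    by rewrite {1}E3 subrr.
  - case: (@natZ_neq0 4%N) => //; have -> : 4%:R = 3 - (-1) * 1 :> Z by ring.
    by rewrite {1}E3 subrr.
  - case: (@natZ_neq0 4%N) => //; have -> : 4%:R = 3 - 1 * -1 :> Z by ring.
    by rewrite {1}E3 subrr.
  - case: (@natZ_neq0 2%N) => //; have -> : 2%:R = 3 - (-1) * -1 :> Z by ring.
    by rewrite {1}E3 subrr.
have vA : v \notin antidiagonal e c by rewrite in_antidiagonal; case: (e).
have vD : v \notin D.
  apply: contra vA => /(subsetP DA); rewrite in_setU1 => /orP[/eqP E|//].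
  by case/negP: wv; rewrite E /moves eqxx.
exists v => // D' domD' sizeD' vD'; apply/negP=> /existsP[f /and3P[_ /eqP fD /forall_inP f_moves]].
have guard t : t \in D' -> exists d, [/\ d \in D, f d = t & moves d t].
  rewrite -fD => /imsetP[d dD tE]; exists d; split=> //.
  by have := f_moves d dD; rewrite tE.
have [e' [c' AD']] := dominating_has_antidiagonal domD' sizeD'.
have inA t : t \in antidiagonal e' c' -> t \in D' := subsetP AD' t.
have inD d : d \in D -> d = ((ew, bw), (p, q)) \/ exists b x, d = ((e, b), (x, c - sgn e * x)).
  move/(subsetP DA); rewrite in_setU1 => /orP[/eqP->|]; first by left.
  case: d => -[e1 b] [x y]; rewrite in_antidiagonal => /andP[/eqP-> /eqP->].
  by right; exists b, x.
have [e'E|e'E] : e' = e \/ e' = ~~ e by case: (e'); case: (e); auto.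
  rewrite {}e'E in inA.
  have [d0 [d0D fd0 d0v]] := guard v vD'.
  case: (inD d0 d0D) => [d0E|[b0 [x1 d0E]]]; first by case/negP: wv; rewrite -d0E.
  have [b0E xvE] : b0 = ~~ bw /\ (xv = x1 \/ xv = x1 + sgn e).
    by move: d0v; rewrite d0E => /moves_cross[-> [[-> _]|[-> _]]]; auto.
  pose i := half * (sgn e * (c' - c)).
  have iE : i + i = sgn e * (c' - c) by apply: halfK.
  pose yt := c' - sgn e * (x1 + i).
  have ytE : yt - (c - sgn e * x1) = sgn e * i.
    have -> : sgn e * i = sgn e * (i + i) - sgn e * i by ring.
    by rewrite iE sgn_mulK /yt; ring.
  (* [t] is where the guard [d0] goes when the antidiagonal slides. *)
  pose near := (sgn e * i == 1) || (sgn e * i == -1).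
  pose t : vertex := ((e, b0 (+) near), (x1 + i, yt)).
  have lt : line e (x1 + i, yt) = x1 + x1 - sgn e * c.
    have -> : line e (x1 + i, yt) = x1 + x1 - sgn e * c + (i + i) - sgn e * (c' - c)
              - (1 - sgn e * sgn e) * (x1 + i).
      by rewrite /line /yt /=; ring.
    by rewrite iE; case: (e); rewrite /sgn; ring.
  have [|h [hD fh ht]] := guard t; first by apply: inA; rewrite in_antidiagonal !eqxx.
  have dbl (z z' : Z) : z + z = z' + z' -> z = z'.
    by move=> E; rewrite -[z]halfK -[z']halfK -!mulrDr E.
  case: (inD h hD) => [hE|[bh [xh hE]]]; rewrite {}hE in ht fh.
    have [ewe|ewe] := eqVneq ew e.
      move: ht; rewrite ewe => /moves_same[]; rewrite {}lt => lw _.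
      have x0E : x0 = x1 by rewrite /x0 -lw subrK mulrDr halfK.
      move: xvE; rewrite /xv ewe eqxx x0E => -[E|E].
        case: (@natZ_neq0 2%N) => //.
        have -> : 2%:R = sgn e * (x1 + 2 * sgn e - x1) by case: (e); rewrite /sgn; ring.
        by rewrite E subrr mulr0.
      case: (@natZ_neq0 1%N) => //.
      have -> : 1%:R = sgn e * (x1 + 2 * sgn e - (x1 + sgn e)) by case: (e); rewrite /sgn; ring.
      by rewrite E subrr mulr0.
    have ewN : ew = ~~ e by case: (ew) ewe; case: (e).
    move: ht; rewrite ewN /t -{2}[e]negbK => /moves_cross[bwE].
    have nearT : near by move: bwE; rewrite b0E; case: (near); case: (bw).
    have iE2 : i = sgn e \/ i = - sgn e.
      by case/orP: nearT => /eqP E; rewrite -[i](sgn_mulK e) E; [left|right]; ring.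
    rewrite sgnN => xtE; have {}xtE : x1 + i = p \/ x1 + i = p - sgn e.
      by case: xtE => -[-> _]; auto.
    have xvE0 : xv = p + 3 by rewrite /xv (negbTE ewe).
    (* In each case the left side is a constant between 1 and 5. *)
    have E : 3 - (xv - x1) - (x1 + i - p) + i = 0 by rewrite xvE0; ring.
    case: xvE E => ->; case: xtE => ->; case: iE2 => ->; case: (e); rewrite /sgn => E.
    all: try by case: (@natZ_neq0 1%N) => //; rewrite -[RHS]E; ring.
    all: try by case: (@natZ_neq0 2%N) => //; rewrite -[RHS]E; ring.
    all: try by case: (@natZ_neq0 3%N) => //; rewrite -[RHS]E; ring.
    all: try by case: (@natZ_neq0 4%N) => //; rewrite -[RHS]E; ring.
    all: try by case: (@natZ_neq0 5%N) => //; rewrite -[RHS]E; ring.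
  (* An antidiagonal guard moving to [t] has the line and the bit of [d0], so it is [d0], which
     already moves to [v]. *)
  move: ht => /moves_same[]; rewrite {}lt => lh nearh.
  have xhE : xh = x1.
    apply: dbl; apply: (addIr (- (sgn e * c))); rewrite lh /line /=.
    by case: (e); rewrite /sgn; ring.
  rewrite xhE ytE -/near in nearh.
  have bhE : bh = b0 by move: nearh; case: (bh); case: (b0); case: (near).
  move: fh; rewrite xhE bhE -d0E fd0 => -[]; case: (e); by [].
rewrite {}e'E in inA.
(* The column where the old and the new antidiagonal cross; the old guard there stands opposite to
   its target and cannot reach it. *)
pose x2 := half * (sgn e * (c - c')).
have cE : c = c' + sgn e * (x2 + x2) by rewrite halfK sgn_mulK; ring.
(* Apart from w, only the guard in column [x2 - sgn e] can move to [t1 b] or to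
   [t2 b], so w has to move to one of them, for both values of [b]. *)
pose t1 b : vertex := ((~~ e, b), (x2, c' + sgn e * x2)).
pose t2 b : vertex := ((~~ e, b), (x2 - sgn e, c' + sgn e * (x2 - sgn e))).
have s0 : sgn e <> 0.
  by move=> E; apply: (@natZ_neq0 1%N) => //; rewrite -[LHS](sgn_mulK e) E mul0r.
have ss : sgn e * sgn e = 1 by case: (e); rewrite /sgn; ring.
have fw b : (f ((ew, bw), (p, q))).1.2 = b.
  have [|h1 [h1D fh1 m1]] := guard (t1 b).
    by apply: inA; rewrite in_antidiagonal sgnN eqxx /=; apply/eqP; ring.
  have [|h2 [h2D fh2 m2]] := guard (t2 b).
    by apply: inA; rewrite in_antidiagonal sgnN eqxx /=; apply/eqP; ring.
  case: (inD h1 h1D) => [h1E|[b1 [x1 h1E]]]; first by rewrite -h1E fh1.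
  case: (inD h2 h2D) => [h2E|[b3 [x3 h2E]]]; first by rewrite -h2E fh2.
  move: m1 m2; rewrite h1E h2E => /moves_cross[b1E x1E] /moves_cross[b3E x3E].
  have {}x1E : x1 = x2 - sgn e.
    case: x1E => [[<- []]|[-> _]]; last by ring.
    by rewrite cE; ring.
  have {}x3E : x3 = x2 - sgn e.
    case: x3E => [[<- //]|[xE yE]].
    have x3E : x3 = x2 - sgn e - sgn e by rewrite xE; ring.
    (* A guard in this column has second coordinate 3 more than [t2 b], while the move allows only a
       difference of 1 or -1. *)
    case: yE; rewrite x3E cE => E.
      case: (@natZ_neq0 4%N) => //.
      have -> : 4%:R = c' + sgn e * (x2 + x2) - sgn e * (x2 - sgn e - sgn e) + 1 -
        (c' + sgn e * (x2 - sgn e)) + 3 * (1 - sgn e * sgn e) by ring.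
      by rewrite ss -E !subrr mulr0 addr0.
    case: (@natZ_neq0 2%N) => //.
    have -> : 2%:R = c' + sgn e * (x2 + x2) - sgn e * (x2 - sgn e - sgn e) - 1 -
      (c' + sgn e * (x2 - sgn e)) + 3 * (1 - sgn e * sgn e) by ring.
    by rewrite ss -E !subrr mulr0 addr0.
  have : t1 b = t2 b by rewrite -fh1 -fh2 h1E h2E b1E b3E x1E x3E.
  move=> /(congr1 (fun u : vertex => u.2.1))/= E; case: s0.
  by rewrite -[LHS](subKr x2) -E subrr.
by have := fw true; rewrite (fw false).
Qed.

Lemma undefended_vertex (D : {set vertex}) :
  dominating torus_adj D -> (#|D| <= 2 * k + 1)%N ->
  exists2 v, v \notin D & forall D', dominating torus_adj D' -> v \in D' ->
    ~~ reconfigures torus_adj D D'.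
Proof.
move=> domD sizeD; have [e [c AD]] := dominating_has_antidiagonal domD sizeD.
have [w DA] := antidiagonal_plus_one AD sizeD.
have [v vD undef] := undefendable AD DA.
exists v => // D' domD' vD'; apply/negP=> rec.
have sizeD' : (#|D'| <= 2 * k + 1)%N.
  case/existsP: (rec) => f /and3P[_ /eqP <- _].
  exact: leq_trans (leq_imset_card _ _) sizeD.
by have := undef D' domD' sizeD' vD'; rewrite rec.
Qed.

End Torus.

(** * Transfer to the Cayley graph *)

(* The presented group acts transitively on 2 k^2 points, by right
   multiplication on the normal forms rho^x tau^e a^y. *)
Section Regular.

Variable k : nat.
Hypothesis k_gt1 : 1 < k.
Local Notation Z := 'Z_k.
Local Open Scope ring_scope.

Let X : finType := (bool * ('Z_k * 'Z_k))%type.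

Let rot (u : X) : X := (u.1, (u.2.1 + sgn k u.1, u.2.2)).
Let flip (u : X) : X := (~~ u.1, u.2).
Let shift (u : X) : X := (u.1, (u.2.1, u.2.2 + 1)).

Let rot_inj : injective rot.
Proof.
by apply: (can_inj (g := fun u => (u.1, (u.2.1 - sgn k u.1, u.2.2)))) => -[e [x y]];
  rewrite /rot /= addrK.
Qed.

Let flip_inj : injective flip.
Proof. by apply: (inv_inj (f := flip)) => -[e p]; rewrite /flip negbK. Qed.

Let shift_inj : injective shift.
Proof.
by apply: (can_inj (g := fun u => (u.1, (u.2.1, u.2.2 - 1)))) => -[e [x y]];
  rewrite /shift /= addrK.
Qed.

Local Open Scope group_scope.

(** The three permutations satisfy the relations, so they generate a quotient of [G], whose order is
    at least the size of the orbit of [base]. *)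
Lemma homGrp_regular (gT : finGroupType) (G : {group gT}) :
  G \isog Grp (r : t : z :
    r ^+ k, t ^+ 2, z ^+ k, z * r = r * z, z * t = t * z, t * r = r^-1 * t) ->
  (2 * k * k <= #|G|)%N.
Proof.
move=> isoG.
pose r := perm rot_inj; pose t := perm flip_inj; pose z := perm shift_inj.
have rX n (u : X) : (r ^+ n) u = (u.1, (u.2.1 + sgn k u.1 *+ n, u.2.2))%R.
  elim: n => [|n IHn]; first by rewrite expg0 perm1 addr0; case: u => ? [].
  by rewrite expgSr permM IHn permE /rot /= mulrSr addrA.
have zX n (u : X) : (z ^+ n) u = (u.1, (u.2.1, u.2.2 + n%:R))%R.
  elim: n => [|n IHn]; first by rewrite expg0 perm1 addr0; case: u => ? [].
  by rewrite expgSr permM IHn permE /shift /= -addrA natr1.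
pose H := (<[r]> <*> <[t]> <*> <[z]>)%G.
have zero_k (v : Z) : (v *+ k = 0)%R by rewrite -mulr_natr pchar_Zp // mulr0.
have homHG : H \homg G.
  rewrite isoG; apply/existsP; exists ((r, t), z).
  rewrite /= !xpair_eqE /= eqxx /=.
  apply/and5P; split.
  - by apply/eqP/permP=> u; rewrite rX zero_k perm1 addr0; case: u => ? [].
  - by apply/eqP/permP=> u; rewrite expgS expg1 permM !permE /flip negbK; case: u.
  - by apply/eqP/permP=> u; rewrite zX pchar_Zp // perm1 addr0; case: u => ? [].
  - by apply/eqP/permP=> u; rewrite !permM !permE.
  - apply/andP; split.
      by apply/eqP/permP=> u; rewrite !permM !permE.
    rewrite eq_sym (can2_eq (mulKVg _) (mulKg _)).
    apply/eqP/permP=> u; rewrite !permM !permE /flip /rot /=.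
    by rewrite sgnN addrK; case: u => ? [].
apply: leq_trans (leq_homg homHG).
have -> : (2 * k * k)%N = #|[set: X]|.
  by rewrite cardsT !card_prod card_bool card_ord Zp_cast // mulnA.
pose base : X := (false, (0, 0))%R.
apply: leq_trans (leq_imset_card (fun s : {perm X} => s base) _).
apply/subset_leq_card/subsetP=> -[e [x y]] _; apply/imsetP.
have rH : r \in H by rewrite mem_gen // inE mem_gen ?inE ?cycle_id.
have tH : t \in H by rewrite mem_gen // inE mem_gen ?inE ?cycle_id ?orbT.
have zH : z \in H by rewrite mem_gen // inE cycle_id orbT.
exists (r ^+ x * t ^+ e * z ^+ y); first by rewrite !groupM ?groupX.
rewrite !permM zX rX /= add0r; case: e; rewrite ?expg1 ?expg0;
  by rewrite permE /flip /= !natr_Zp add0r.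
Qed.

End Regular.

(** * Domination and reconfiguration under a graph isomorphism *)

Section Isomorphism.

Variables (T T' : finType) (e : rel T) (e' : rel T') (phi : T -> T') (psi : T' -> T).
Hypotheses (phiK : cancel phi psi) (psiK : cancel psi phi).
Hypothesis phi_adj : forall u v, e' (phi u) (phi v) = e u v.

Lemma dominating_iso (D : {set T'}) : dominating e (phi @^-1: D) = dominating e' D.
Proof.
have phi_inj := can_inj phiK.
apply/forallP/forallP=> domD w.
  have /exists_inP[u uD uw] := domD (psi w); apply/exists_inP; exists (phi u).
    by rewrite inE in uD.
  by rewrite -[w]psiK /dominates (inj_eq phi_inj) phi_adj.
have /exists_inP[u uD uw] := domD (phi w); apply/exists_inP; exists (psi u).
  by rewrite inE psiK.
by move: uw; rewrite -[u]psiK /dominates (inj_eq phi_inj) phi_adj psiK.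
Qed.

Lemma reconfigures_iso (D D' : {set T'}) :
  reconfigures e' D D' -> reconfigures e (phi @^-1: D) (phi @^-1: D').
Proof.
have phi_inj := can_inj phiK; have psi_inj := can_inj psiK.
case/existsP=> f /and3P[/dinjectiveP f_inj /eqP fD /forall_inP f_moves].
apply/existsP; exists [ffun u => psi (f (phi u))]; apply/and3P; split.
- apply/dinjectiveP=> u v; rewrite !inE !ffunE => uD vD /psi_inj /f_inj.
  by move=> /(_ uD vD)/phi_inj.
- apply/eqP/setP=> u; rewrite inE -fD; apply/imsetP/imsetP=> [[d]|[d dD dE]].
    by rewrite inE ffunE => dD ->; exists (phi d); rewrite ?psiK.
  by exists (psi d); rewrite ?inE ?ffunE ?psiK // -dE phiK.
- apply/forall_inP=> u; rewrite inE ffunE => /f_moves.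
  by rewrite -(inj_eq phi_inj) -phi_adj psiK.
Qed.

End Isomorphism.

(** * From undefended vertices to a bound on eternal domination *)

Section Eternal.

Variables (T : finType) (e : rel T).

Lemma reconfigures_dominates D D' w :
  reconfigures e D D' -> w \in D' -> [exists u in D, dominates e u w].
Proof.
case/existsP=> f /and3P[_ /eqP <- /forall_inP f_moves] /imsetP[d dD ->].
by apply/exists_inP; exists d; rewrite // /dominates f_moves.
Qed.

(** An unoccupied vertex is entered by some guard in a single move, so that guard dominates it. *)
Lemma configuration_dominating C D :
  eternal_dominating_configuration e C -> D \in C -> dominating e D.
Proof.
case/and3P=> _ _ /forall_inP defend DC; apply/forallP=> w.
case: (boolP (w \in D)) => [wD|wD].
  by apply/exists_inP; exists w; rewrite // /dominates eqxx.
have /forallP/(_ w) := defend D DC; rewrite wD => /exists_inP[D' _ /andP[wD' rec]].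
exact: reconfigures_dominates rec wD'.
Qed.

Lemma undefended_lt_eternal n :
  (forall D, dominating e D -> #|D| <= n ->
     exists2 v, v \notin D & forall D', dominating e D' -> v \in D' ->
       ~~ reconfigures e D D') ->
  n < eternal_domination_number e.
Proof.
move=> undef; rewrite /eternal_domination_number.
case: arg_minnP => [|D /existsP[C /andP[confC DC]] _]; first exact: eternal_dominating_setT.
rewrite ltnNge; apply/negP=> Dn.
have [v vD vN] := undef D (configuration_dominating confC DC) Dn.
case/and3P: (confC) => _ _ /forall_inP/(_ D DC)/forallP/(_ v).
rewrite vD => /exists_inP[D' D'C /andP[vD' rec]].
by have := vN D' (configuration_dominating confC D'C) vD'; rewrite rec.
Qed.

End Eternal.

(** * Normal forms in the group and the connection set *)

Section Coordinates.

Variables (k : nat) (gT : finGroupType) (rho tau a b : gT).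
Hypothesis k_ge17 : 17 <= k.
Hypothesis hG : Delta_group k rho tau a b.
Local Notation Z := 'Z_k.
Local Notation vertex := (vertex k).
Local Open Scope group_scope.

Let k_gt1 : 1 < k. Proof. by apply: leq_trans k_ge17. Qed.

Let rhoX : rho ^+ k = 1. Proof. by case: hG => [[[]]]. Qed.
Let tauX : tau ^+ 2 = 1. Proof. by case: hG => [[[]]]. Qed.
Let aX : a ^+ k = 1. Proof. by case: hG => [[[]]]. Qed.
Let bX : b ^+ 2 = 1. Proof. by case: hG => _ _ <- _ _; rewrite expg_order. Qed.

Let rhoG : rho \in Gk rho tau a. Proof. by rewrite mem_gen // !inE eqxx. Qed.
Let tauG : tau \in Gk rho tau a. Proof. by rewrite mem_gen // !inE eqxx orbT. Qed.
Let aG : a \in Gk rho tau a. Proof. by rewrite mem_gen // !inE eqxx !orbT. Qed.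

Let a_cent g : g \in Gk rho tau a -> commute a g.
Proof. by move: g; case: hG => -[_ /centerP[_ aC] _ _] _ _ _ _ g /aC. Qed.

Let b_cent g : g \in Gk rho tau a -> commute b g.
Proof. by move=> gG; case: hG => _ _ _ /centP/(_ g gG). Qed.

Lemma expgZD (g : gT) (x y : Z) : g ^+ k = 1 -> g ^+ (x + y)%R = g ^+ x * g ^+ y.
Proof.
move=> gk; rewrite -expgD -(expg_mod (x + y) gk); congr (g ^+ _).
by rewrite -val_Zp_nat // natrD !natr_Zp.
Qed.

Lemma expgZN (g : gT) (x : Z) : g ^+ k = 1 -> g ^+ (- x)%R = (g ^+ x)^-1.
Proof.
by move=> gk; apply: (mulgI (g ^+ x)); rewrite mulgV -expgZD // subrr.
Qed.

Lemma expgZ1 (g : gT) : g ^+ (1 : Z)%R = g.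
Proof.
by have := val_Zp_nat k_gt1 1; rewrite modn_small // => ->.
Qed.

Definition coord (u : vertex) : gT :=
  rho ^+ u.2.1 * tau ^+ u.1.1 * a ^+ u.2.2 * b ^+ u.1.2.

Lemma coordE e b1 (x y : Z) :
  coord ((e, b1), (x, y)) = rho ^+ x * tau ^+ e * a ^+ y * b ^+ b1.
Proof. by []. Qed.

Lemma tau_rho (e : bool) (x : Z) : tau ^+ e * rho ^+ x = rho ^+ (sgn k e * x)%R * tau ^+ e.
Proof.
case: e; rewrite /sgn ?mulN1r ?mul1r ?expg0 ?mulg1 ?mul1g // expg1.
have rel : rho ^ tau^-1 = rho^-1.
  by case: hG => -[_ _ E _] _ _ _ _; rewrite conjgE invgK mulgA E mulgK.
rewrite expgZN // -expVgn -rel -conjXg conjgE invgK mulgA mulgVK.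
by [].
Qed.

(** Powers of [a] and [b] move past the other factors freely; moving [tau ^+ e] past a power of
    [rho] costs the sign in [tau_rho]. *)
Lemma coordM (e b1 e' b1' : bool) (x y x' y' : Z) :
  coord ((e, b1), (x, y)) * coord ((e', b1'), (x', y')) =
  coord ((e (+) e', b1 (+) b1'), (x + sgn k e * x', y + y'))%R.
Proof.
rewrite !coordE !expgZD //.
have -> : tau ^+ (e (+) e') = tau ^+ e * tau ^+ e'.
  by case: e; case: e'; rewrite ?expg0 ?expg1 ?mulg1 ?mul1g // -tauX.
have -> : b ^+ (b1 (+) b1') = b ^+ b1 * b ^+ b1'.
  by case: b1; case: b1'; rewrite ?expg0 ?expg1 ?mulg1 ?mul1g // -bX.
have bC n g : g \in Gk rho tau a -> b ^+ n * g = g * b ^+ n.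
  by move=> gG; apply/commute_sym/commuteX/commute_sym/b_cent.
have aC n g : g \in Gk rho tau a -> a ^+ n * g = g * a ^+ n.
  by move=> gG; apply/commute_sym/commuteX/commute_sym/a_cent.
rewrite !mulgA -(mulgA _ (b ^+ b1) (rho ^+ _)) (bC _ _ (groupX _ rhoG)) !mulgA.
rewrite -(mulgA _ (b ^+ b1) (tau ^+ _)) (bC _ _ (groupX _ tauG)) !mulgA.
rewrite -(mulgA _ (b ^+ b1) (a ^+ _)) (bC _ _ (groupX _ aG)) !mulgA.
rewrite -(mulgA _ (a ^+ y) (rho ^+ _)) (aC _ _ (groupX _ rhoG)) !mulgA.
rewrite -(mulgA _ (a ^+ y) (tau ^+ _)) (aC _ _ (groupX _ tauG)) !mulgA.
by rewrite -(mulgA _ (tau ^+ e) (rho ^+ _)) tau_rho !mulgA.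
Qed.

Let rhoE : rho = coord ((false, false), (1, 0))%R.
Proof. by rewrite /coord /= expgZ1 !expg0 !mulg1. Qed.
Let tauE : tau = coord ((true, false), (0, 0))%R.
Proof. by rewrite /coord /= !expg0 !mulg1 mul1g. Qed.
Let aE : a = coord ((false, false), (0, 1))%R.
Proof. by rewrite /coord /= expgZ1 !expg0 !mulg1 !mul1g. Qed.
Let bE : b = coord ((false, true), (0, 0))%R.
Proof. by rewrite /coord /= !expg0 !mul1g. Qed.

(** By [coordM] the normal forms are closed under products, hence a subgroup of the finite group,
    and they include the generators. *)
Lemma coord_onto : coord @: setT = setT.
Proof.
have gR : group_set (coord @: setT).
  apply/group_setP; split.
    by apply/imsetP; exists ((false, false), (0, 0))%R; rewrite // /coord /= !expg0 !mulg1.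
  move=> _ _ /imsetP[[[e b1] [x y]] _ ->] /imsetP[[[e' b1'] [x' y']] _ ->].
  by rewrite coordM imset_f.
apply/eqP; rewrite -subTset; case: hG => _ _ _ _ <-.
rewrite (gen_subG _ (Group gR)) subUset sub1set /= bE imset_f ?inE //=.
rewrite (gen_subG _ (Group gR)) !subUset !sub1set /=.
by rewrite rhoE tauE aE !imset_f.
Qed.

Let card_vertex : #|{: vertex}| = (4 * k * k)%N.
Proof. by rewrite !card_prod !card_bool !card_Z // mulnA. Qed.

(** A surjection is injective once its target is large enough: [Gk] has at least [2 * k * k]
    elements by [homGrp_regular], and index at least 2 because of [b]. *)
Lemma coord_inj : injective coord.
Proof.
suff: {in setT &, injective coord} by move=> inj u v; apply: inj; rewrite inE.
apply: onto_inj coord_onto _; rewrite cardsT card_vertex.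
have [[_ _ _ isoG] bG _ _ _] := hG.
have := homGrp_regular k_gt1 isoG.
have := Lagrange (subsetT (Gk rho tau a)); rewrite cardsT => <-.
have : 1 < #|[set: gT] : Gk rho tau a|.
  by rewrite indexg_gt1; apply: contra bG => /subsetP; apply; rewrite inE.
move=> lt1 leG; have -> : (4 * k * k = 2 * k * k * 2)%N by lia.
exact: leq_mul.
Qed.

(** The bound of the ordinal type ['Z_k] equals [k] only propositionally, so the indices in [Sk] are
    transported by value. *)
Let ord_Z (i : 'I_k) : exists2 z : Z, nat_of_ord z = i & (0 < i) = (z != 0)%R.
Proof.
have iE : nat_of_ord ((nat_of_ord i)%:R : Z)%R = i by rewrite val_Zp_nat // modn_small.
exists (nat_of_ord i)%:R%R => //; rewrite -[in LHS]iE lt0n; congr (~~ _).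
Qed.

Let inv_pair : rho^-1 * a^-1 = coord ((false, false), (-1, -1))%R.
Proof. by rewrite coordE !expgZN // !expgZ1 !expg0 !mulg1. Qed.

Definition origin : vertex := ((false, false), (0, 0))%R.

(** Exchanging [rho * a] and its inverse for their products with [b] is what the bit condition of
    [torus_adj] on neighbours along a line expresses. *)
Lemma coord_Tk u : (coord u \in Tk k rho tau a b) = torus_adj origin u.
Proof.
case: u => -[e b1] [x y].
have tauaE (z : Z) : tau * a ^+ z = coord ((true, false), (0%R, z)).
  by rewrite /coord /= !expg0 !mulg1 mul1g.
have rhoaE (z : Z) : rho ^+ z * a ^+ z = coord ((false, false), (z, z)).
  by rewrite /coord /= !expg0 !mulg1.
have rtE : rho * tau * a = coord ((true, false), (1, 1))%R.
  by rewrite /coord /= !expgZ1 !expg0 !mulg1.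
have rtNE : rho * tau * a^-1 = coord ((true, false), (1, -1))%R.
  by rewrite coordE expgZN // !expgZ1 !expg0 !mulg1.
have raE : rho * a = coord ((false, false), (1, 1))%R.
  by rewrite /coord /= !expgZ1 !expg0 !mulg1.
have rabE : rho * a * b = coord ((false, true), (1, 1))%R.
  by rewrite /coord /= !expgZ1 !expg0 !mulg1.
have rabNE : rho^-1 * a^-1 * b = coord ((false, true), (-1, -1))%R.
  by rewrite coordE !expgZN // !expgZ1 !expg0 !mulg1.
rewrite !inE rtE rtNE rabE rabNE raE inv_pair !(inj_eq coord_inj).
have -> : (coord ((e, b1), (x, y)) \in [set tau * a ^+ (i : nat) | i : 'I_k & 0 < i]) =
    [&& e, ~~ b1, x == 0 & y != 0]%R.
  apply/imsetP/and4P => [[i]|[]].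
    have [z zi i0] := ord_Z i; rewrite inE i0 -zi tauaE => z0 /coord_inj[-> -> -> ->].
    by rewrite eqxx.
  case: e; case: b1 => // _ _ /eqP-> y0.
  have yk : y < k by have := ltn_ord y; rewrite [X in _ < X -> _]Zp_cast.
  exists (Ordinal yk); rewrite ?inE /= ?tauaE // lt0n.
  by apply: contra y0 => /eqP y0; apply/eqP/val_inj.
have -> : (coord ((e, b1), (x, y)) \in
      [set rho ^+ (i : nat) * a ^+ (i : nat) | i : 'I_k & 0 < i]) =
    [&& ~~ e, ~~ b1, x == y & y != 0]%R.
  apply/imsetP/and4P => [[i]|[]].
    have [z zi i0] := ord_Z i; rewrite inE i0 -zi rhoaE => z0 /coord_inj[-> -> -> ->].
    by rewrite eqxx.
  case: e; case: b1 => // _ _ /eqP-> y0.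
  have yk : y < k by have := ltn_ord y; rewrite [X in _ < X -> _]Zp_cast.
  exists (Ordinal yk); rewrite ?inE /= ?rhoaE // lt0n.
  by apply: contra y0 => /eqP y0; apply/eqP/val_inj.
rewrite /torus_adj /origin !subr0 add0r !xpair_eqE.
have diag z : (x == z) && (y == z) = (x == y) && (y == z).
  by case: (eqVneq y z) => [->|]; rewrite ?andbT ?andbF.
have near_neq0 : ((y == 1) || (y == -1))%R -> (y != 0)%R.
  by case/orP=> /eqP->; rewrite ?oppr_eq0 oner_neq0.
case: e; case: b1; rewrite /= ?andbT ?andbF ?orbF ?mul1r //.
- by rewrite -andb_orr.
- rewrite !diag -andb_orr; case: (x == y) => //=.
  by case: (_ || _) near_neq0 => [->|_] //; case: (y != 0%R).
- rewrite !diag -andb_orr; case: (x == y) => //=.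
  by case: (_ || _); case: (y != 0%R).
Qed.

(** Left translation reduces to [u = origin], with [d] the coordinates of the quotient. *)
Lemma Delta_coord u v : Delta k rho tau a b (coord u) (coord v) = torus_adj u v.
Proof.
case: u v => -[e b1] [x y] [[e' b1'] [x' y']].
pose d : vertex := ((e (+) e', b1 (+) b1'), (sgn k e * (x' - x), y' - y))%R.
have vE : coord ((e', b1'), (x', y')) = coord ((e, b1), (x, y)) * coord d.
  rewrite coordM sgn_mulK !addKb; congr (coord (_, (_, _)))%R.
    by rewrite addrC subrK.
  by rewrite addrC subrK.
have -> : Delta k rho tau a b (coord ((e, b1), (x, y))) (coord ((e', b1'), (x', y'))) =
    (coord d \in Tk k rho tau a b).
  apply/exists_inP/idP => [[s sT]|dT]; last by exists (coord d); rewrite ?vE.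
  by rewrite vE => /eqP/mulgI->.
rewrite {vE}coord_Tk /d {d} /torus_adj /origin !subr0 add0r.
have -> : (false == b1 (+) b1') = (b1 == b1') by case: b1; case: b1'.
rewrite subr_eq0; case: e; case: e'; rewrite /= ?mul1r ?mulN1r //.
- by rewrite eqr_oppLR.
- by rewrite oppr_eq0 subr_eq0 (eqr_oppLR (x' - x)) (subr_eq x') (addrC x).
- by rewrite subr_eq0 (subr_eq x') (addrC x).
Qed.

End Coordinates.

Theorem theorem5p15 (k : nat) (hk : 17 <= k) (hodd : odd k)
    (gT : finGroupType) (rho tau a b : gT)
    (hG : Delta_group k rho tau a b) :
  (forall D : {set gT},
     dominating (Delta k rho tau a b) D -> #|D| <= 2 * k + 1 ->
     exists2 v : gT, v \notin D &
       forall D' : {set gT},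
         dominating (Delta k rho tau a b) D' -> v \in D' ->
         ~~ reconfigures (Delta k rho tau a b) D D')
  /\ 2 * k + 2 <= eternal_domination_number (Delta k rho tau a b)
  /\ 2 * k + 2 = domination_number (Delta k rho tau a b) + 2.
Proof.
set E := Delta _ _ _ _ _.
pose phi := @coord k gT rho tau a b.
have phi_inj : injective phi := coord_inj hk hG.
have [psi phiK psiK] : bijective phi.
  apply: (inj_card_bij phi_inj); rewrite -!cardsT -(coord_onto hk hG).
  exact: leq_imset_card.
have phi_adj u v : E (phi u) (phi v) = torus_adj u v := Delta_coord hk hG u v.
have card_phi (D : {set gT}) : #|phi @^-1: D| = #|D|.
  by apply: on_card_preimset; exists psi => u _.
have dom_phi (D : {set gT}) : dominating E D -> dominating (@torus_adj k) (phi @^-1: D).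
  by rewrite (dominating_iso phiK psiK phi_adj).
have part1 (D : {set gT}) : dominating E D -> #|D| <= 2 * k + 1 ->
    exists2 v : gT, v \notin D & forall D' : {set gT}, dominating E D' -> v \in D' ->
      ~~ reconfigures E D D'.
  move=> /dom_phi domD; rewrite -card_phi => sizeD.
  have [v vD undef] := undefended_vertex hk hodd domD sizeD.
  exists (phi v); first by rewrite inE in vD.
  move=> D' domD' vD'; apply/negP=> /(reconfigures_iso phiK psiK phi_adj) rec.
  by have := undef _ (dom_phi _ domD'); rewrite inE rec => /(_ vD').
split=> //; split.
  by rewrite addnS; apply: undefended_lt_eternal.
congr (_ + 2); rewrite /domination_number.
case: arg_minnP => [|D domD minD]; first exact: dominating_setT.
apply/eqP; rewrite eqn_leq; apply/andP; split; last first.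
  have := minD (psi @^-1: @antidiagonal k false 0%R).
  have psi_adj u v : torus_adj (psi u) (psi v) = E u v by rewrite -phi_adj !psiK.
  rewrite (dominating_iso psiK phiK psi_adj).
  rewrite on_card_preimset; last by exists phi => u _.
  rewrite card_antidiagonal //; apply; exact: dominating_antidiagonal0.
(* A smaller dominating set would still contain an antidiagonal, which has [2 * k] vertices. *)
rewrite leqNgt; apply/negP=> sizeD.
have [e [c AD]] : exists e c, @antidiagonal k e c \subset phi @^-1: D.
  apply: dominating_has_antidiagonal => //; first exact: dom_phi.
  by rewrite card_phi; lia.
by have := subset_leq_card AD; rewrite card_antidiagonal // card_phi leqNgt sizeD.
Qed.
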